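(* For any $\gamma\in\mathbb{R}$ and $\beta\in(0,1)$ there exists an optimal Markov policy $\pi\in\Pi^*(\beta,\gamma)$ that is ultimately stationary.
   Context: Setting (finite discounted risk-sensitive MDP). $E=\{x_1,\dots,x_k\}$ is a finite state space and $U=\{\tilde u_1,\dots,\tilde u_l\}$ a finite action space (both nonempty); every action is available in every state. For $a\in U$, $P^a=[p_a(x_i,x_j)]_{i,j=1}^k$ is a transition probability matrix. $c\colon E\times U\to\mathbb{R}$ is a fixed running reward. $(X_n)_{n\ge 0}$ is the canonical state process. A policy is a sequence $\pi=(a_n)_{n\ge0}$, where $a_n$ is a $U$-valued function of $(X_0,\dots,X_n)$; $\Pi$ is the set of all policies. $\mathbb{E}_x^\pi$ is the expectation under the law of the process with $X_0=x$ and $\mathbb{P}(X_{n+1}=y\mid X_0,\dots,X_n)=p_{a_n}(X_n,y)$. $\Pi''\subset\Pi$ is the set of Markov policies, identified with sequences $(u_n)_{n\ge0}$, $u_n\colon E\to U$, via $a_n=u_n(X_n)$. $\Pi'\subset\Pi''$ is the set of stationary Markov policies, identified with functions $u\colon E\to U$, via $a_n=u(X_n)$ for all $n$. For $\gamma\in\mathbb{R}$, $\beta\in(0,1)$, $x\in E$, $\pi=(a_i)_{i\ge 0}\in\Pi$, put $$J_\gamma(x,\pi;\beta):=\begin{cases}\frac1\gamma\ln\mathbb{E}_x^\pi\big[e^{\gamma\sum_{i=0}^\infty\beta^i c(X_i,a_i)}\big],&\gamma\ne0,\\ \mathbb{E}_x^\pi\big[\sum_{i=0}^\infty\beta^i c(X_i,a_i)\big],&\gamma=0.\end{cases}$$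 $\Pi^*(\beta,\gamma)$ is the set of Markov policies $\pi\in\Pi''$ that are optimal for every starting point, i.e. $J_\gamma(x,\pi;\beta)=\sup_{\pi'\in\Pi}J_\gamma(x,\pi';\beta)$ for all $x\in E$. A Markov policy $\pi\in\Pi''$ is ultimately stationary if there exist $N\in\mathbb{N}$ and $u_0,u_1,\dots,u_{N-1},u\in\Pi'$ (functions $E\to U$) such that $\pi=(u_0,u_1,\dots,u_{N-1},u,u,\dots)$. *)

(* Defs.v *)
From HB Require Import structures.
From mathcomp Require Import all_boot all_order all_algebra.
From mathcomp Require Import all_classical all_reals all_analysis.
From mathcomp Require Import lra.
Set Implicit Arguments.
Unset Strict Implicit.
Unset Printing Implicit Defensive.
Import Order.TTheory GRing.Theory Num.Theory.
Import numFieldNormedType.Exports.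
Local Open Scope classical_set_scope.
Local Open Scope ring_scope.

(* The canonical space of trajectories of E. A [measurableType] has to be
   pointed, hence the parameter [x] (the initial state), which provides the
   point; the set of trajectories itself does not depend on it. *)
Definition trajectory (E : finType) (x : E) : Type := nat -> E.

HB.instance Definition _ (E : finType) (x : E) :=
  gen_eqMixin (trajectory x).
HB.instance Definition _ (E : finType) (x : E) :=
  gen_choiceMixin (trajectory x).
HB.instance Definition _ (E : finType) (x : E) :=
  isPointed.Build (trajectory x) (fun=> x).

Definition coordinate_events (E : finType) (x : E) : set (set (trajectory x)) :=
  [set A | exists n (y : E), A = [set w | w n = y]].
Arguments coordinate_events {E} x _.

HB.instance Definition _ (E : finType) (x : E) :=
  @isMeasurable.Build (sigma_display (coordinate_events x)) (trajectory x)
    <<s coordinate_events x >>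
    (@sigma_algebra0 _ setT (coordinate_events x))
    (@sigma_algebraC _ (coordinate_events x))
    (@sigma_algebra_bigcup _ setT (coordinate_events x)).

Definition history (E : finType) (x : E) (n : nat) (w : trajectory x) :
  n.+1.-tuple E := [tuple w i | i < n.+1].

Definition policy (E U : finType) : Type := forall n : nat, n.+1.-tuple E -> U.

Definition markov_policy (E U : finType) : Type := nat -> E -> U.

Definition policy_of_markov (E U : finType) (u : markov_policy E U) :
  policy E U := fun n h => u n (tnth h ord_max).

(* u = (us_0, ..., us_(N-1), v, v, ...) with N = size us *)
Definition ultimately_stationary (E U : finType) (u : markov_policy E U) :=
  exists (us : seq (E -> U)) (v : E -> U), forall n, u n = nth v us n.

Section mdp.
Context {R : realType} {E U : finType}.
Implicit Types (p : U -> E -> E -> R) (c : E -> U -> R) (x y : E).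
Implicit Types (pi : policy E U) (g b : R).

Definition transition_matrix (q : E -> E -> R) : Prop :=
  (forall x y, 0 <= q x y) /\ (forall x, \sum_y q x y = 1).

(* P(X_0 = x) = 1 and P(X_(n+1) = y | X_0, ..., X_n) = p_(a_n)(X_n, y), the
   conditional probability being written in product form so that histories of
   probability zero impose no constraint. *)
Definition is_path_law p pi x (P : probability (trajectory x) R) : Prop :=
  P [set w | w 0%N = x] = 1%E /\
  forall n (h : n.+1.-tuple E) y,
    P [set w | history n w = h /\ w n.+1 = y] =
    (P [set w | history n w = h] * (p (pi n h) (tnth h ord_max) y)%:E)%E.

(* When every [p a] is a transition matrix, this law exists ([path_lawP]) and
   is unique ([is_path_law_unique]), so that the default value of [get] is
   never used. *)
Definition path_law p pi x : probability (trajectory x) R :=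
  get [set P | is_path_law p pi P].

Definition discounted_reward c b pi x (w : trajectory x) : R :=
  limn (series (fun i => b ^+ i * c (w i) (pi i (history i w)))).

Definition J p c g x pi b : R :=
  if g == 0 then fine 'E_(path_law p pi x)[fun w => discounted_reward c b pi w]
  else g^-1 * ln (fine
    'E_(path_law p pi x)[fun w => expR (g * discounted_reward c b pi w)]).

(* The supremum is taken in the extended reals because [sup] is [0] by default
   on unbounded sets of reals. *)
Definition optimal_markov p c b g : set (markov_policy E U) :=
  [set u | forall x, (J p c g x (policy_of_markov u) b)%:E =
     ereal_sup [set (J p c g x pi b)%:E | pi in [set: policy E U]]].

End mdp.

(* Existence of the law: a nonnegative kernel q giving the conditional
   probabilities of the next state splits [0, 1[ into nested intervals indexed
   by histories, the interval of a history having its probability as length;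
   the trajectory read off a uniform point of [0, 1[ has the required law.
   Histories are reversed here (most recent state first). *)
Module PathConstruction.
Section cells.
Context {R : realType} {E : finType} (x : E) (q : seq E -> E -> R).
Hypothesis q_ge0 : forall r y, 0 <= q r y.
Hypothesis q_sum1 : forall r, \sum_y q r y = 1.

Definition cdf_lt r (y : E) := \sum_(z | (enum_rank z < enum_rank y)%N) q r z.
Local Notation F := cdf_lt.

Lemma cdf_ltD r y :
  F r y + q r y = \sum_(z | (enum_rank z <= enum_rank y)%N) q r z.
Proof.
rewrite [RHS](bigD1 y)//= addrC; congr (_ + _); apply: eq_bigl => z.
by rewrite ltn_neqAle andbC (inj_eq (@ord_inj _)) (inj_eq enum_rank_inj).
Qed.

Lemma sub_sum r (A B : pred E) : subpred A B ->
  \sum_(z | A z) q r z <= \sum_(z | B z) q r z.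
Proof.
move=> AB; rewrite big_mkcond [leRHS]big_mkcond; apply: ler_sum => z _.
by case: ifP => [/AB ->//|_]; case: ifP.
Qed.

Lemma cdf_ge0 r y : 0 <= F r y. Proof. exact: sumr_ge0. Qed.

Lemma cdf_le1 r y : F r y + q r y <= 1.
Proof. by rewrite cdf_ltD -(q_sum1 r); exact: sub_sum. Qed.

Lemma cdf_lt_le r y z : (enum_rank y < enum_rank z)%N -> F r y + q r y <= F r z.
Proof.
by move=> yz; rewrite cdf_ltD; apply: sub_sum => t ty; exact: leq_ltn_trans yz.
Qed.

Lemma cdf_cover r w t : 0 <= t < w ->
  exists y, w * F r y <= t < w * (F r y + q r y).
Proof.
move=> /andP[t0 tw]; have w0 : 0 < w := le_lt_trans t0 tw.
pose A y := t < w * (F r y + q r y).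
have [m Am] : exists m, A m.
  case: (@arg_maxnP _ x xpredT (fun y => val (enum_rank y)) isT) => m _ mm.
  exists m; rewrite /A cdf_ltD (eq_bigl xpredT) ?q_sum1 ?mulr1// => z.
  exact: mm.
case: (@arg_minnP _ m A (fun y => val (enum_rank y)) Am) => y Ay ymin.
exists y; rewrite [X in _ && X]Ay andbT leNgt; apply/negP => tF.
have [y0|y0] := posnP (enum_rank y).
  by move: tF; rewrite /F big_pred0 ?mulr0 ?ltNge ?t0// => z; rewrite y0.
have ly : ((enum_rank y).-1 < #|E|)%N.
  by rewrite (leq_ltn_trans (leq_pred _)).
have := ymin (enum_val (Ordinal ly)); rewrite enum_valK /= leqNgt.
rewrite prednK// leqnn => /(_ _)/negP[]//.
rewrite /A cdf_ltD (eq_bigl (fun z => enum_rank z < enum_rank y)%N)// => z.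
by rewrite enum_valK/= -ltnS prednK.
Qed.

Fixpoint cell_lo_wd (r : seq E) : R * R :=
  if r is y :: r' then
    let: (l, w) := cell_lo_wd r' in (l + w * F r' y, w * q r' y)
  else (0, 1).
Definition lo r := (cell_lo_wd r).1.
Definition wd r := (cell_lo_wd r).2.

Lemma lo_cons y r : lo (y :: r) = lo r + wd r * F r y.
Proof. by rewrite /lo /wd /=; case: cell_lo_wd. Qed.
Lemma wd_cons y r : wd (y :: r) = wd r * q r y.
Proof. by rewrite /lo /wd /=; case: cell_lo_wd. Qed.

Lemma wd_ge0 r : 0 <= wd r.
Proof. by elim: r => [|y r IH]; rewrite ?ler01// wd_cons mulr_ge0. Qed.

Definition in_cell r (u : R) := lo r <= u < lo r + wd r.

Lemma in_cell_tl y r u : in_cell (y :: r) u -> in_cell r u.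
Proof.
rewrite /in_cell lo_cons wd_cons -addrA -mulrDr => /andP[a b].
have := mulr_ge0 (wd_ge0 r) (cdf_ge0 r y).
have := ler_wpM2l (wd_ge0 r) (cdf_le1 r y).
rewrite mulr1; lra.
Qed.

Lemma in_cell_inj y z r u : in_cell (y :: r) u -> in_cell (z :: r) u -> y = z.
Proof.
rewrite /in_cell !lo_cons !wd_cons -!addrA -!mulrDr => /andP[a b] /andP[c d].
case: (ssrnat.ltngtP (enum_rank y) (enum_rank z)) => [||/ord_inj/enum_rank_inj//].
- by move=> lt; exfalso; have := ler_wpM2l (wd_ge0 r) (@cdf_lt_le r _ _ lt); lra.
- by move=> lt; exfalso; have := ler_wpM2l (wd_ge0 r) (@cdf_lt_le r _ _ lt); lra.
Qed.

Lemma in_cell_ex r u : in_cell r u -> exists y, in_cell (y :: r) u.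
Proof.
move=> /andP[a b]; have [|y /andP[c d]] := @cdf_cover r (wd r) (u - lo r).
  lra.
exists y; rewrite /in_cell lo_cons wd_cons -addrA -mulrDr; lra.
Qed.

Lemma in_cell01 r u : in_cell r u -> 0 <= u < 1.
Proof.
by elim: r => [|y r IH /in_cell_tl//]; rewrite /in_cell /lo /wd/= add0r.
Qed.

Definition next r u : E := odflt x [pick y | in_cell (y :: r) u].

Lemma in_cell_next r y u : in_cell (y :: r) u -> next r u = y.
Proof.
rewrite /next; case: pickP => [z zr yr|/(_ y) -> //].
exact: in_cell_inj zr yr.
Qed.

Fixpoint run n u := if n is m.+1 then next (run m u) u :: run m u else [::].

Lemma size_run n u : size (run n u) = n.
Proof. by elim: n => //= n ->. Qed.

Lemma run_cell r u : 0 <= u < 1 -> (run (size r) u == r) = in_cell r u.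
Proof.
move=> u01; elim: r => [|y r IH] /=.
  by rewrite eqxx /in_cell /lo /wd /= add0r u01.
rewrite eqseq_cons IH; apply/andP/idP => [[/eqP <-] ur|yu].
- have ru : run (size r) u = r by apply/eqP; rewrite IH.
  have [z zr] := in_cell_ex ur.
  by rewrite ru (in_cell_next zr).
- have := in_cell_tl yu; rewrite -IH => ur; split => //.
  by rewrite (eqP ur) (in_cell_next yu).
Qed.

Definition cell r : set R := [set u | in_cell r u].

Lemma cellE r : cell r = `[lo r, lo r + wd r[%classic.
Proof. by apply/seteqP; split => u; rewrite /cell /= in_itv. Qed.

Lemma measurable_cell r : measurable (cell r).
Proof. by rewrite cellE; exact: measurable_itv. Qed.

Lemma lebesgue_cell r : lebesgue_measure (cell r) = (wd r)%:E.
Proof.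
rewrite cellE lebesgue_measure_itv /= lte_fin ltrDl -EFinB addrAC subrr add0r.
by have := wd_ge0 r; rewrite le_eqVlt => /predU1P[<-|->]//; rewrite ltxx.
Qed.

Lemma measurable_next r y : measurable [set u | next r u = y].
Proof.
have -> : [set u | next r u = y] = cell (y :: r) `|`
    (if y == x then \bigcap_z ~` cell (z :: r) else set0).
  apply/seteqP; split => u /=.
    rewrite /next; case: pickP => /= [z zr <-|nz <-]; first by left.
    by right; rewrite eqxx => z _ /=; rewrite /cell /= nz.
  case=> [/in_cell_next//|]; case: eqP => // -> uz.
  by rewrite /next; case: pickP => // z zr; have := uz z Logic.I zr.
apply: measurableU; first exact: measurable_cell.
case: ifP => _ //; apply: fin_bigcap_measurable => // z _.
by apply: measurableC; exact: measurable_cell.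
Qed.

Lemma measurable_run r : measurable [set u | run (size r) u = r].
Proof.
elim: r => [|y r IH]; first by rewrite (_ : mkset _ = setT) //; apply/seteqP.
rewrite (_ : mkset _ = [set u | run (size r) u = r] `&` [set u | next r u = y]).
  by apply: measurableI => //; exact: measurable_next.
apply/seteqP; split=> u /= => [[<- ru]|[-> ->]//].
by rewrite ru.
Qed.

Definition traj_of (u : R) : trajectory x := fun n => head x (run n.+1 u).

Lemma mkseq_traj_of u n : mkseq (traj_of u) n = rev (run n u).
Proof. by elim: n => // n IH; rewrite mkseqS IH /= rev_cons. Qed.

Lemma measurable_traj_of : measurable_fun setT (traj_of : measurableTypeR R -> trajectory x).
Proof.
apply: (@measurability _ _ _ _ setT _ (coordinate_events x)) => //.
move=> _ [_ [n [y ->]] <-]; rewrite setTI.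
have -> : traj_of @^-1` [set w | w n = y] =
    \bigcup_(r in [set: n.-tuple E]) [set u | run n.+1 u = y :: r].
  apply/seteqP; split => u /=.
    rewrite /traj_of /= => <-; exists (Tuple (introT eqP (size_run n u))) => //.
  by case=> r _ /=; rewrite /traj_of /= => -[].
apply: fin_bigcup_measurable => // r _.
by have := measurable_run (y :: r); rewrite /= size_tuple.
Qed.

Lemma trajectory_measure_exists : exists P : probability (trajectory x) R,
  forall r, P [set w | mkseq w (size r) = rev r] = (wd r)%:E.
Proof.
pose D := [set u : R | 0 <= u < 1].
have DE : D = cell [::] by apply/seteqP; split=> u; rewrite /D /cell /in_cell /lo /wd /= add0r.
have mD : measurable D by rewrite DE; exact: measurable_cell.
pose L : probability (measurableTypeR R) R :=
  mnormalize (mrestr lebesgue_measure mD) (@dirac _ (measurableTypeR R) 0 R).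
have LE A : L A = lebesgue_measure (A `&` D).
  have DT : mrestr lebesgue_measure mD setT = 1%E.
    by rewrite /mrestr setTI DE lebesgue_cell.
  by rewrite /L /= /mnormalize /= DT /= onee_eq0 /= invr1 mule1.
pose X : {mfun (measurableTypeR R) >-> trajectory x} :=
  HB.pack traj_of (@isMeasurableFun.Build _ _ _ _ _ measurable_traj_of).
exists (distribution L X) => r; rewrite -lebesgue_cell.
rewrite [LHS](LE _).
congr (lebesgue_measure _); apply/seteqP; split => u /=.
  rewrite mkseq_traj_of => -[/(can_inj revK) ru u01].
  by rewrite /cell/= -run_cell// ru.
move=> ur; have u01 := in_cell01 ur; split => //.
by rewrite mkseq_traj_of; congr rev; apply/eqP; rewrite run_cell.
Qed.

End cells.
End PathConstruction.

Lemma historyE (E : finType) (x : E) n (w : trajectory x) :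
  history n w = mkseq w n.+1 :> seq E.
Proof.
rewrite /history /= /mkseq -val_enum_ord -map_comp.
by [].
Qed.

Lemma history_eq (E : finType) (x : E) n (h : n.+1.-tuple E) (w : trajectory x) :
  history n w = h <-> mkseq w n.+1 = h.
Proof.
rewrite -historyE; split => [-> //|wh]; exact/val_inj.
Qed.

Lemma last_tnth (E : finType) (x : E) n (h : n.+1.-tuple E) :
  last x h = tnth h ord_max.
Proof. by rewrite (tnth_nth x) (last_nth x) size_tuple. Qed.

Lemma measurable_coordinate (E : finType) (x : E) n (y : E) :
  measurable [set w : trajectory x | w n = y].
Proof. by apply: sub_sigma_algebra; exists n, y. Qed.

Lemma measurable_prefix (E : finType) (x : E) (s : seq E) :
  measurable [set w : trajectory x | mkseq w (size s) = s].
Proof.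
elim/last_ind: s => [|s y IH].
  by rewrite (_ : mkset _ = setT) //; apply/seteqP.
rewrite (_ : mkset _ = [set w : trajectory x | mkseq w (size s) = s] `&`
  [set w | w (size s) = y]); last first.
  apply/seteqP; split => w /=; rewrite size_rcons mkseqS.
    by move=> /rcons_inj[].
  by move=> [-> ->].
by apply: measurableI => //; exact: measurable_coordinate.
Qed.

Lemma measurable_prefixE (E : finType) (x : E) :
  @measurable _ (trajectory x) =
  <<s [set A | A = set0 \/
       exists s, A = [set w : trajectory x | mkseq w (size s) = s]] >>.
Proof.
set G : set (set (trajectory x)) := (X in <<s X >>); apply/seteqP; split; last first.
  apply: smallest_sub; first exact: sigma_algebra_measurable.
  by move=> _ [->|[s ->]]; [exact: measurable0|exact: measurable_prefix].
apply: smallest_sub; first exact: smallest_sigma_algebra.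
move=> _ [n [y ->]].
rewrite (_ : mkset _ = \bigcup_(h in [set: n.-tuple E])
    [set w : trajectory x | mkseq w n.+1 = rcons h y]); last first.
  apply/seteqP; split => w /=.
    move=> <-; have sw : size (mkseq w n) == n by rewrite size_mkseq.
    by exists (Tuple sw) => //=; rewrite mkseqS.
  by case=> h _ /=; rewrite mkseqS => /rcons_inj[].
change (G.-sigma.-measurable (\bigcup_(h in [set: n.-tuple E])
    [set w : trajectory x | mkseq w n.+1 = rcons h y])).
apply: fin_bigcup_measurable => // h _.
apply: sub_sigma_algebra; right; exists (rcons h y).
by rewrite size_rcons size_tuple.
Qed.

Lemma setI_closed_prefix (E : finType) (x : E) : setI_closed
  [set A | A = set0 \/ exists s, A = [set w : trajectory x | mkseq w (size s) = s]].
Proof.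
move=> A B [->|[s ->]]; first by left; rewrite set0I.
move=> [->|[t ->]]; first by left; rewrite setI0.
wlog st : s t / (size s <= size t)%N => [H|].
  by case/orP: (leq_total (size s) (size t)) => /H//; rewrite setIC.
have takeE (w : trajectory x) : take (size s) (mkseq w (size t)) = mkseq w (size s).
  by rewrite /mkseq -map_take take_iota (minn_idPl st).
have [ts|ts] := eqVneq (take (size s) t) s; [right; exists t|left];
  apply/seteqP; split => w //=.
- by case.
- by move=> wt; split=> //; rewrite -takeE wt.
- by case=> ws wt; move/eqP: ts; apply; rewrite -[in LHS]wt takeE.
Qed.

Lemma measurable_history (E : finType) (x : E) n (h : n.+1.-tuple E) :
  measurable [set w : trajectory x | history n w = h].
Proof.
have := measurable_prefix (x := x) h; rewrite size_tuple.
by congr measurable; apply/seteqP; split => w /= /history_eq.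
Qed.

Section law.
Context {R : realType} {E U : finType}.
Variables (p : U -> E -> E -> R) (pi : policy E U) (x : E).
Hypothesis p_trans : forall a, transition_matrix (p a).

Let q (r : seq E) (y : E) : R :=
  if rev r is z :: h then p (pi (in_tuple (z :: h))) (last z h) y
  else (y == x)%:R.

Let qE n (h : n.+1.-tuple E) y : q (rev h) y = p (pi h) (tnth h ord_max) y.
Proof.
rewrite /q revK -(last_tnth x); case: h => -[//|z h] /= e.
have en : size h = n by apply/eqP.
move: e; rewrite -{}en => e; congr (p (pi _) _ _); exact/val_inj.
Qed.

Lemma is_path_law_exists : exists P, is_path_law (x := x) p pi P.
Proof.
have q0 r y : 0 <= q r y.
  by rewrite /q; case: rev => [//|z h]; exact: (p_trans _).1.
have q1 r : \sum_y q r y = 1.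
  rewrite /q; case: rev => [|z h]; last exact: (p_trans _).2.
  by rewrite (bigD1 x)//= eqxx big1 ?addr0// => y /negbTE ->.
have [P PE] := PathConstruction.trajectory_measure_exists x q0 q1.
exists P; split.
  have := PE [:: x]; rewrite PathConstruction.wd_cons /q /= eqxx mulr1 /PathConstruction.wd /= => <-.
  by congr (P _); apply/seteqP; split => w /=; rewrite /mkseq /=; [move=> ->|case].
move=> n h y.
rewrite (_ : [set w | history n w = h] = [set w | mkseq w n.+1 = h]); last first.
  by apply/seteqP; split => w /= /history_eq.
have := PE (y :: rev h); rewrite PathConstruction.wd_cons qE EFinM -PE /= size_rev size_tuple.
rewrite rev_cons revK => <-; congr (P _); apply/seteqP; split => w /=.
  by move=> [/history_eq wh wy]; rewrite mkseqS wh wy.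
by rewrite mkseqS => /rcons_inj[/history_eq].
Qed.

Lemma is_path_law_unique P Q :
  is_path_law (x := x) p pi P -> is_path_law (x := x) p pi Q ->
  forall A, measurable A -> P A = Q A.
Proof.
move=> PL QL.
have stepE n (h : n.+1.-tuple E) y : [set w : trajectory x | mkseq w n.+2 = rcons h y]
    = [set w | history n w = h /\ w n.+1 = y].
  apply/seteqP; split => w /=.
    by rewrite mkseqS => /rcons_inj[/history_eq].
  by move=> [/history_eq wh wy]; rewrite mkseqS wh wy.
have PQ s : P [set w | mkseq w (size s) = s] = Q [set w | mkseq w (size s) = s].
  elim/last_ind: s => [|s y IH].
    by rewrite (_ : mkset _ = setT) ?probability_setT//; apply/seteqP.
  case: s IH => [_|z s IH] /=.
    have aux L : is_path_law (x := x) p pi L ->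
        L [set w | [:: w 0] = [:: y]] = (y == x)%:R%:E.
      move=> [L1 _].
      have [->|yx] := eqVneq y x.
        by rewrite -L1; congr (L _); apply/seteqP; split => w /=; [case|move=> ->].
      apply/eqP; rewrite -measure_le0.
      have <- : L (~` [set w | w 0%N = x]) = 0%E.
        by rewrite probability_setC ?L1 ?subee//; exact: measurable_coordinate.
      apply: le_measure; rewrite ?inE.
      + exact: (@measurable_prefix _ x [:: y]).
      + by apply: measurableC; exact: measurable_coordinate.
      + by move=> w /= [wy] wx; move/eqP: yx; apply; rewrite -wy -wx.
    by rewrite (aux P) ?(aux Q).
  have := stepE _ (in_tuple (z :: s)) y.
  rewrite size_rcons => /= ->; rewrite PL.2 QL.2; congr (_ * _)%E.
  have -> : [set w : trajectory x | history (size s) w = in_tuple (z :: s)] =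
      [set w | mkseq w (size (z :: s)) = z :: s].
    by apply/seteqP; split => w /(history_eq (in_tuple (z :: s)) w).
  exact: IH.
move=> A mA.
apply: (measure_unique _ (fun=> setT) (measurable_prefixE x)) => //.
- exact: setI_closed_prefix.
- by move=> _; right; exists [::]; apply/seteqP.
- by rewrite bigcup_const.
- by move=> B [->|[s ->]]; [rewrite !measure0|exact: PQ].
- by move=> k /=; rewrite probability_setT ltry.
Qed.

Lemma path_lawP : is_path_law p pi (path_law p pi x).
Proof. exact: getPex is_path_law_exists. Qed.
End law.

(* Main.v *)
Require Import Defs.
From mathcomp Require Import all_boot all_order all_algebra.
From mathcomp Require Import all_classical all_reals all_analysis.
From mathcomp Require Import measurable_realfun ring lra.
Set Implicit Arguments.
Unset Strict Implicit.
Unset Printing Implicit Defensive.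
Import Order.TTheory GRing.Theory Num.Theory.
Import numFieldNormedType.Exports.
Local Open Scope classical_set_scope.
Local Open Scope ring_scope.

(** Write z for the current risk parameter and S for the discounted total
    reward. One step of the process replaces the problem with parameter z by the
    problem with parameter z * beta, since
      exp (z S) = exp (z c(X_0, a_0)) * exp ((z beta) S'),
    S' being the total reward of the trajectory shifted by one step. So
    an optimal Markov policy for gamma uses at time n an action that is optimal for
    the parameter gamma * beta ^ n, and the theorem says that near the parameter 0
    one stationary choice of actions is always right.

    Multiplying by the sign tau of gamma turns both signs of gamma into the
    maximization of tau * E exp (z S) ([exp_value]), and the one-step operator
    [bellman] is monotone for either sign. A sequence W that solves the
    Bellman optimality equations along gamma * beta ^ n and tends to tau at a
    geometric rate bounds the value of every policy, and is attained by the
    policy selecting the maximizing actions ([bellman_solution_optimal]):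
    exp (z S_n) * W_n(X_n) has nonincreasing mean under every policy.

    The heart is that finitely many comparisons settle near 0. For f : E -> U the
    value of the stationary policy f is a power series in z, whose coefficients are
    moments of S ([power_series_germ_mean]). Hence for every state x and action a
    the gain obtained by playing a once in x before following f is a power series
    too, and along gamma * beta ^ n it is eventually nonpositive or eventually
    positive ([power_series_germ_sign]). There are finitely many triples (f, x, a),
    so one rank M serves all. Choose f maximizing the sum over all states of its
    value at rank M. If some action were profitable in x at every rank from
    M on, playing it always in x would improve f at all these ranks
    ([policy_improvement]), strictly at rank M, against maximality. So f solves the
    Bellman equations at every rank n >= M ([stationary_solution_near0]); the
    first M decisions are recovered by backward induction
    ([bellman_solution_backward]).

    When gamma = 0 the f obtained for the parameters beta ^ n is optimal
    as well, by comparing first-order terms: E exp (z S) = 1 + z E S + O(z ^ 2). *)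

(** * Means of bounded random variables *)

Section bounded_random_variables.
Context {d} {T : measurableType d} {R : realType} (P : probability T R).
Implicit Types (f g : T -> R) (r M : R).

Definition mean f : R := fine 'E_P[f].

Definition bounded_rv f := measurable_fun setT f /\ exists M, forall w, `|f w| <= M.

Lemma bounded_rv_integrable f :
  bounded_rv f -> P.-integrable setT (EFin \o f).
Proof.
move=> [mf [M fM]]; apply: measurable_bounded_integrable => //.
  exact: fin_num_fun_lty (fin_num_measure P).
exists M; split; first exact: num_real.
by move=> r Mr w _; exact: le_trans (fM w) (ltW Mr).
Qed.

Lemma meanE f : mean f = \int[P]_w f w.
Proof. by rewrite /mean unlock. Qed.

Lemma bounded_rv_cst r : bounded_rv (cst r).
Proof. by split; [exact: measurable_cst|exists `|r|]. Qed.

Lemma bounded_rvD f g :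
  bounded_rv f -> bounded_rv g -> bounded_rv (fun w => f w + g w).
Proof.
move=> [mf [M fM]] [mg [N gN]]; split; first exact: measurable_funD.
by exists (M + N) => w; apply: le_trans (ler_normD _ _) _; exact: lerD.
Qed.

Lemma bounded_rvM f g :
  bounded_rv f -> bounded_rv g -> bounded_rv (fun w => f w * g w).
Proof.
move=> [mf [M fM]] [mg [N gN]]; split; first exact: measurable_funM.
by exists (M * N) => w; rewrite normrM; exact: ler_pM.
Qed.

Lemma bounded_rvZ r f : bounded_rv f -> bounded_rv (fun w => r * f w).
Proof. by move=> bf; apply: bounded_rvM => //; exact: bounded_rv_cst. Qed.

Lemma bounded_rvB f g :
  bounded_rv f -> bounded_rv g -> bounded_rv (fun w => f w - g w).
Proof.
move=> bf bg; apply: bounded_rvD => //.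
by under eq_fun do rewrite -mulN1r; exact: bounded_rvZ.
Qed.

Lemma bounded_rv_sum I (s : seq I) (f : I -> T -> R) :
  (forall i, bounded_rv (f i)) -> bounded_rv (fun w => \sum_(i <- s) f i w).
Proof.
move=> bf; elim: s => [|i s IH].
  by under eq_fun do rewrite big_nil; exact: bounded_rv_cst.
by under eq_fun do rewrite big_cons; exact: bounded_rvD.
Qed.

Lemma bounded_rvX f n : bounded_rv f -> bounded_rv (fun w => f w ^+ n).
Proof.
move=> bf; elim: n => [|n IH].
  by under eq_fun do rewrite expr0; exact: bounded_rv_cst.
by under eq_fun do rewrite exprS; exact: bounded_rvM.
Qed.

Lemma bounded_rv_expR f : bounded_rv f -> bounded_rv (fun w => expR (f w)).
Proof.
move=> [mf [M fM]]; split; first exact: measurableT_comp.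
exists (expR M) => w; rewrite ger0_norm ?expR_ge0// ler_expR.
exact: le_trans (ler_norm _) (fM w).
Qed.

Lemma bounded_rv_indic (A : set T) : measurable A -> bounded_rv (\1_A).
Proof.
move=> mA; split; first exact: measurable_indic.
by exists 1 => w; rewrite indicE; case: (w \in A); rewrite ?normr1 ?normr0.
Qed.

Lemma mean_cst r : mean (cst r) = r.
Proof. by rewrite /mean expectation_cst. Qed.

Lemma meanD f g : bounded_rv f -> bounded_rv g ->
  mean (fun w => f w + g w) = mean f + mean g.
Proof. by move=> bf bg; rewrite !meanE RintegralD//; exact: bounded_rv_integrable. Qed.

Lemma meanZ r f : bounded_rv f -> mean (fun w => r * f w) = r * mean f.
Proof. by move=> bf; rewrite !meanE RintegralZl//; exact: bounded_rv_integrable. Qed.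

Lemma meanB f g : bounded_rv f -> bounded_rv g ->
  mean (fun w => f w - g w) = mean f - mean g.
Proof. by move=> bf bg; rewrite !meanE RintegralB//; exact: bounded_rv_integrable. Qed.

Lemma mean_sum I (s : seq I) (f : I -> T -> R) :
  (forall i, bounded_rv (f i)) ->
  mean (fun w => \sum_(i <- s) f i w) = \sum_(i <- s) mean (f i).
Proof.
move=> bf; elim: s => [|i s IH].
  by under [X in mean X]eq_fun do rewrite big_nil; rewrite big_nil mean_cst.
under [X in mean X]eq_fun do rewrite big_cons.
by rewrite big_cons -IH meanD//; exact: bounded_rv_sum.
Qed.

Lemma le_mean f g : bounded_rv f -> bounded_rv g ->
  (forall w, f w <= g w) -> mean f <= mean g.
Proof.
by move=> bf bg fg; rewrite !meanE le_Rintegral//; exact: bounded_rv_integrable.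
Qed.

Lemma mean_indic A : measurable A -> mean (\1_A) = fine (P A).
Proof. by move=> mA; rewrite /mean expectation_indic. Qed.

Lemma norm_mean_le f M : bounded_rv f -> (forall w, `|f w| <= M) -> `|mean f| <= M.
Proof.
move=> bf fM; rewrite ler_norml -[leLHS]mean_cst -[X in _ && (_ <= X)]mean_cst.
by apply/andP; split; apply: le_mean => //; try exact: bounded_rv_cst;
  move=> w; have := fM w; rewrite ler_norml => /andP[].
Qed.

Lemma mean_expR_gt0 f : bounded_rv f -> 0 < mean (fun w => expR (f w)).
Proof.
move=> bf; have [_ [M fM]] := bf.
apply: (@lt_le_trans _ _ (expR (- M))); first exact: expR_gt0.
rewrite -[leLHS]mean_cst; apply: le_mean; first exact: bounded_rv_cst.
  exact: bounded_rv_expR.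
by move=> w; rewrite ler_expR; have := fM w; rewrite ler_norml => /andP[].
Qed.

Lemma bounded_rv_lim (h : nat -> T -> R) f M : (forall n, bounded_rv (h n)) ->
  (forall n w, `|h n w| <= M) -> (forall w, h ^~ w @ \oo --> f w) ->
  bounded_rv f.
Proof.
move=> bh hM hf; split.
  by apply: (measurable_fun_cvg (h := h)) => // n; exact: (bh n).1.
exists M => w.
have hw : `|h n w| @[n --> \oo] --> `|f w| by apply: cvg_norm; exact: hf.
rewrite -(cvg_lim _ hw)//; apply: limr_le; first by apply/cvg_ex; eexists; exact: hw.
exact: nearW.
Qed.

(** Bounded convergence; [bounded_rv_lim] supplies the integrability of the
    limit. *)
Lemma cvg_mean (h : nat -> T -> R) f M : (forall n, bounded_rv (h n)) ->
  (forall n w, `|h n w| <= M) -> (forall w, h ^~ w @ \oo --> f w) ->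
  mean (h n) @[n --> \oo] --> mean f.
Proof.
move=> bh hM hf; have bf := bounded_rv_lim bh hM hf.
have [|||||_ _] := @dominated_convergence _ T R P setT measurableT
   (fun n w => (h n w)%:E) (fun w => (f w)%:E) (cst M%:E).
- by move=> n; apply/measurable_EFinP; exact: (bh n).1.
- by apply/measurable_EFinP; exact: bf.1.
- by apply: aeW => w _; apply: cvg_EFin; [exact: nearW|exact: hf].
- exact: bounded_rv_integrable (bounded_rv_cst M).
- by apply: aeW => w n _ /=; rewrite lee_fin.
move=> H; under eq_fun do rewrite meanE.
rewrite meanE; apply: fine_cvg; rewrite /= fineK //.
exact: integrable_fin_num (bounded_rv_integrable bf).
Qed.

End bounded_random_variables.

(** * Germs of power series at 0 *)

Section taylor.
Context {R : realType}.
Implicit Types (x y : R).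

Lemma exp_coeff_partial_sum_le x n : 0 <= x ->
  \sum_(0 <= k < n) x ^+ k / k`!%:R <= expR x.
Proof.
move=> x0; apply: nondecreasing_cvgn_le; last exact: is_cvg_series_exp_coeff.
by apply/nondecreasing_seqP => m; rewrite
  /series /= big_nat_recr//= lerDl divr_ge0// exprn_ge0.
Qed.

(** Compare the tail of the series term by term with [`|y| ^+ n] times the series
    of [expR `|y|], using k! <= (k + n)!. *)
Lemma expR_taylor y n :
  `|expR y - \sum_(k < n) y ^+ k / k`!%:R| <= `|y| ^+ n * expR `|y|.
Proof.
rewrite -(big_mkord xpredT (fun k => y ^+ k / k`!%:R)).
have cvgE : `|\sum_(0 <= k < m) y ^+ k / k`!%:R - \sum_(0 <= k < n) y ^+ k / k`!%:R|
    @[m --> \oo] --> `|expR y - \sum_(0 <= k < n) y ^+ k / k`!%:R|.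
  apply: cvg_norm; apply: cvgB; last exact: cvg_cst.
  exact: is_cvg_series_exp_coeff.
rewrite -(cvg_lim _ cvgE)//; apply: limr_le; first by apply/cvg_ex; eexists; exact: cvgE.
exists n => // m /= nm; rewrite (big_cat_nat (leq0n n) nm)//= addrAC subrr add0r.
apply: le_trans (ler_norm_sum _ _ _) _.
apply: (@le_trans _ _ (`|y| ^+ n * \sum_(0 <= k < m - n) `|y| ^+ k / k`!%:R)); last first.
  by rewrite ler_wpM2l ?exprn_ge0// exp_coeff_partial_sum_le.
rewrite -{1}[n]add0n big_addn mulr_sumr; apply: ler_sum => k _.
rewrite normrM normrX normfV (ger0_norm (ler0n _ _)) mulrA -exprD addnC.
rewrite ler_wpM2l ?exprn_ge0// lef_pV2 ?posrE ?ltr0n ?fact_gt0// ler_nat.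
by rewrite leq_fact// leq_addl.
Qed.

(** The remainder estimate makes [D] the sum of the power series with
    coefficients [a] near 0. It is preferred to convergence because
    it is additive, holds for moment generating functions by Taylor's formula
    under the mean, and yields at once the leading term ([K = k + 1]) and the
    identity theorem ([K] tending to infinity). *)
Definition power_series_germ (D : R -> R) (a : nat -> R) :=
  exists C M : R, [/\ 0 <= C, 0 <= M & forall K z, `|z| <= 1 ->
    `|D z - \sum_(k < K) a k * z ^+ k| <= C * (M * `|z|) ^+ K].

Lemma power_series_germD D1 D2 a1 a2 :
  power_series_germ D1 a1 -> power_series_germ D2 a2 ->
  power_series_germ (fun z => D1 z + D2 z) (fun k => a1 k + a2 k).
Proof.
move=> [C1 [M1 [C10 M10 H1]]] [C2 [M2 [C20 M20 H2]]].
exists (C1 + C2), (M1 + M2); split; rewrite ?addr_ge0// => K z z1.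
under eq_bigr do rewrite mulrDl.
rewrite big_split /= opprD addrACA; apply: le_trans (ler_normD _ _) _.
rewrite mulrDl; apply: lerD.
  apply: le_trans (H1 K z z1) _; rewrite ler_wpM2l// lerXn2r ?nnegrE ?mulr_ge0 ?addr_ge0//.
  by rewrite ler_wpM2r// lerDl.
apply: le_trans (H2 K z z1) _; rewrite ler_wpM2l// lerXn2r ?nnegrE ?mulr_ge0 ?addr_ge0//.
by rewrite ler_wpM2r// lerDr.
Qed.

Lemma power_series_germZ r D a : power_series_germ D a ->
  power_series_germ (fun z => r * D z) (fun k => r * a k).
Proof.
move=> [C [M [C0 M0 H]]]; exists (`|r| * C), M; split; rewrite ?mulr_ge0// => K z z1.
under eq_bigr do rewrite -mulrA.
by rewrite -mulr_sumr -mulrBr normrM -mulrA ler_wpM2l// H.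
Qed.

Lemma power_series_germ0 : power_series_germ (fun=> 0) (fun=> 0).
Proof.
exists 0, 0; split=> // K z _; rewrite big1 ?subrr ?normr0 ?mul0r//.
by move=> k _; rewrite mul0r.
Qed.

Lemma power_series_germ_sum I (s : seq I) (D : I -> R -> R) a :
  (forall i, power_series_germ (D i) (a i)) ->
  power_series_germ (fun z => \sum_(i <- s) D i z) (fun k => \sum_(i <- s) a i k).
Proof.
move=> Da; elim: s => [|i s IH].
  under eq_fun do rewrite big_nil; under [X in power_series_germ _ X]eq_fun do rewrite big_nil.
  exact: power_series_germ0.
under eq_fun do rewrite big_cons; under [X in power_series_germ _ X]eq_fun do rewrite big_cons.
exact: power_series_germD.
Qed.

Lemma power_series_germ_mean d (T : measurableType d) (P : probability T R) Y :
  bounded_rv Y ->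
  power_series_germ (fun z => mean P (fun w => expR (z * Y w)))
                    (fun k => mean P (fun w => Y w ^+ k) / k`!%:R).
Proof.
move=> bY; have [_ [M0 YM0]] := bY.
pose M := `|M0|; have M_ge0 : 0 <= M by exact: normr_ge0.
have YM w : `|Y w| <= M by apply: le_trans (YM0 w) (ler_norm _).
exists (expR M), M; split; rewrite ?expR_ge0// => K z z1.
have bz : bounded_rv (fun w => z * Y w) by exact: bounded_rvZ.
have be := bounded_rv_expR bz.
have bk (k : 'I_K) : bounded_rv (fun w => (z * Y w) ^+ k / k`!%:R).
  under eq_fun do rewrite mulrC; apply: bounded_rvZ; exact: bounded_rvX.
have -> : \sum_(k < K) mean P (fun w => Y w ^+ k) / k`!%:R * z ^+ k =
    mean P (fun w => \sum_(k < K) (z * Y w) ^+ k / k`!%:R).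
  rewrite mean_sum//; apply: eq_bigr => k _.
  rewrite -mulrA mulrC -meanZ; last exact: bounded_rvX.
  by congr mean; apply/funext => w; rewrite exprMn; ring.
rewrite -meanB//; last exact: bounded_rv_sum.
apply: norm_mean_le.
  by apply: bounded_rvB => //; exact: bounded_rv_sum.
move=> w; apply: le_trans (expR_taylor _ _) _.
have zM : `|z * Y w| <= M * `|z| by rewrite normrM mulrC ler_wpM2r.
rewrite mulrC; apply: ler_pM; rewrite ?expR_ge0 ?exprn_ge0//.
  rewrite ler_expR; apply: le_trans zM _; exact: ler_piMr.
by rewrite lerXn2r ?nnegrE ?mulr_ge0.
Qed.

(** The remainder bound tends to 0 as the number of terms grows, as soon as
    [M * `|z|] < 1. *)
Lemma power_series_germ_eq0 D a : power_series_germ D a -> (forall k, a k = 0) ->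
  exists2 r, 0 < r & forall z, `|z| < r -> D z = 0.
Proof.
move=> [C [M [C0 M0 H]]] a0.
(* [M + 1] and not [M], so that the radius is defined and at most 1. *)
exists (M + 1)^-1; first by rewrite invr_gt0; lra.
move=> z; rewrite -[_^-1]mul1r ltr_pdivlMr; last by lra.
move=> zM.
have zM1 : M * `|z| < 1 by have := normr_ge0 z; nra.
have z1 : `|z| <= 1 by have := normr_ge0 z; nra.
apply/eqP; rewrite -normr_eq0 eq_le normr_ge0 andbT.
have lim0 : C * (M * `|z|) ^+ K @[K --> \oo] --> 0.
  rewrite -[X in _ --> X](mulr0 C); apply: cvgM; first exact: cvg_cst.
  by apply: cvg_expr; rewrite ger0_norm ?mulr_ge0.
rewrite -(cvg_lim _ lim0)//; apply: limr_ge; first by apply/cvg_ex; eexists; exact: lim0.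
apply: nearW => K; have := H K z z1; rewrite big1 ?subr0// => k _.
by rewrite a0 mul0r.
Qed.

(** Near 0 the first nonvanishing term dominates the remainder, so it
    dictates the sign. *)
Lemma power_series_germ_leading D a k : power_series_germ D a ->
  (forall j, (j < k)%N -> a j = 0) -> a k != 0 ->
  exists2 r, 0 < r & forall z, 0 < `|z| < r -> 0 < D z * (a k * z ^+ k).
Proof.
move=> [C [M [C0 M0 H]]] a0 ak.
set B := C * M ^+ k.+1; have B0 : 0 <= B by rewrite mulr_ge0 ?exprn_ge0.
have A0 : 0 < `|a k| by rewrite normr_gt0.
(* For such [z], the remainder [B * `|z| ^+ k.+1] is less than `|a k| * `|z| ^+ k,
   and `|z| <= 1. *)
exists (`|a k| / (B + `|a k|)); first by rewrite divr_gt0//; lra.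
move=> z /andP[z0]; rewrite ltr_pdivlMr; last by lra.
move=> zB.
have z1 : `|z| <= 1 by nra.
have := H k.+1 z z1; rewrite big_ord_recr/= big1 ?add0r; last first.
  by move=> j _; rewrite a0 ?mul0r.
rewrite exprMn [C * _]mulrA -/B => hD.
have : `|D z - a k * z ^+ k| < `|a k * z ^+ k|.
  apply: le_lt_trans hD _.
  rewrite normrM normrX exprS mulrA ltr_pM2r ?exprn_gt0//.
  by nra.
move: (a k * z ^+ k) => y; clear; rewrite ltr_norml => /andP[].
case: (ger0P y) => y0 h1 h2.
  have y_gt0 : 0 < y by lra.
  by apply: mulr_gt0 => //; lra.
by rewrite nmulr_rgt0//; lra.
Qed.

(** Either all coefficients vanish, and the function is 0 near 0, or its sign is that
    of its leading term, which is constant along [g * b ^+ n] because these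
    points all have the sign of [g]. *)
Lemma power_series_germ_sign D a g b : power_series_germ D a ->
  0 < b < 1 -> exists N,
  (forall n, (N <= n)%N -> D (g * b ^+ n) <= 0) \/
  (forall n, (N <= n)%N -> 0 < D (g * b ^+ n)).
Proof.
move=> Da /andP[b0 b1].
have near0 r : 0 < r -> exists N, forall n, (N <= n)%N -> `|g * b ^+ n| < r.
  move=> r0; have : g * b ^+ n @[n --> \oo] --> 0.
    rewrite -[X in _ --> X](mulr0 g); apply: cvgM; first exact: cvg_cst.
    by apply: cvg_expr; rewrite ger0_norm ?ltW.
  move/cvgrPdist_lt => /(_ r r0)[N _ HN]; exists N => n Nn.
  by have := HN n Nn; rewrite /= sub0r normrN.
have [a0|] := pselect (forall k, a k = 0).
  have [r r0 Dr] := power_series_germ_eq0 Da a0.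
  by have [N HN] := near0 r r0; exists N; left => n Nn; rewrite Dr ?HN.
move/existsNP => [k0 /eqP ak0].
have [k ak kmin] := ex_minnP (ex_intro (fun k => a k != 0) k0 ak0).
have [|r r0 Dr] := power_series_germ_leading Da _ ak.
  by move=> j; rewrite ltnNge => /negP jk; apply/eqP/negPn/negP => /kmin.
have [N HN] := near0 r r0; exists N.
have [g0|g0] := eqVneq g 0.
  rewrite g0; have [D0|D0] := lerP (D 0) 0; [left|right] => n _; by rewrite mul0r.
have [agk|agk] := ltrP 0 (a k * g ^+ k); [right|left] => n Nn.
all: have := Dr (g * b ^+ n); rewrite normr_gt0 mulf_neq0//= ?expf_neq0 ?gt_eqF// HN//.
all: move=> /(_ isT); rewrite exprMn -exprM [a k * _]mulrA.
all: have bnk := exprn_gt0 (n * k) b0.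
  by rewrite pmulr_lgt0// mulr_gt0.
move=> h; rewrite leNgt; apply/negP => D0; move: h.
by rewrite pmulr_rgt0// ltNge mulr_le0_ge0// ltW.
Qed.

End taylor.

(** * Trajectories and the path law *)

Section histories.
Context {R : realType} {E U : finType} (x : E).
Implicit Types (w : trajectory x) (g : trajectory x -> R).

Definition history_adapted n g := forall w w', history n w = history n w' -> g w = g w'.

(** Any trajectory starting with [h] would do: it is only used to evaluate adapted
    functions on histories. *)
Definition extend_history n (h : n.+1.-tuple E) : trajectory x := nth x h.

Lemma history_extend n (h : n.+1.-tuple E) : history n (extend_history h) = h.
Proof.
apply/history_eq; rewrite /extend_history.
by have := mkseq_nth x h; rewrite size_tuple.
Qed.

Lemma history_widen n m w w' : (m <= n)%N -> history n w = history n w' ->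
  history m w = history m w'.
Proof.
move=> mn ww'; apply: eq_from_tnth => i; rewrite !tnth_mktuple.
have i_n : (i < n.+1)%N by rewrite (leq_trans (ltn_ord i)).
by have := congr1 (fun h : n.+1.-tuple E => tnth h (Ordinal i_n)) ww'; rewrite !tnth_mktuple.
Qed.

Lemma history_last n w w' : history n w = history n w' -> w n = w' n.
Proof.
by move/(congr1 (fun h : n.+1.-tuple E => tnth h ord_max)); rewrite !tnth_mktuple.
Qed.

Lemma extend_history_last n (h : n.+1.-tuple E) : extend_history h n = tnth h ord_max.
Proof. by rewrite (tnth_nth x). Qed.

(** There are finitely many histories of a given length, so an adapted function is
    a finite combination of indicators of events whose probabilities are known. *)
Lemma history_adaptedE n g w : history_adapted n g ->
  g w = \sum_(h : n.+1.-tuple E)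
    g (extend_history h) * \1_[set w' : trajectory x | history n w' = h] w.
Proof.
move=> gn; rewrite (bigD1 (history n w))//= big1 ?addr0.
  rewrite indicE mem_set//= mulr1; apply: gn; by rewrite history_extend.
move=> h /eqP hw; rewrite indicE memNset ?mulr0//= => wh; exact/hw.
Qed.

Lemma bounded_rv_history_adapted n g : history_adapted n g -> bounded_rv g.
Proof.
move=> gn; rewrite (funext (fun w => history_adaptedE w gn)).
apply: bounded_rv_sum => h; apply: bounded_rvZ; apply: bounded_rv_indic.
exact: measurable_history.
Qed.

Context (P : probability (trajectory x) R).

Lemma mean_history_adapted n g : history_adapted n g ->
  mean P g = \sum_(h : n.+1.-tuple E)
    g (extend_history h) * fine (P [set w | history n w = h]).
Proof.
move=> gn; rewrite [in LHS](funext (fun w => history_adaptedE w gn)).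
have bi (h : n.+1.-tuple E) := bounded_rv_indic (R := R) (measurable_history (x := x) h).
rewrite mean_sum => [|h]; last exact: bounded_rvZ.
by apply: eq_bigr => h _; rewrite meanZ// mean_indic//; exact: measurable_history.
Qed.

Context (p : U -> E -> E -> R) (pi : policy E U).
Hypothesis P_law : is_path_law (x := x) p pi P.

Lemma mean_initial_state (W : E -> R) : mean P (fun w => W (w 0%N)) = W x.
Proof.
have m0 y : measurable [set w : trajectory x | w 0%N = y] by exact: measurable_coordinate.
have b0 y := bounded_rv_indic (R := R) (m0 y).
have -> : (fun w : trajectory x => W (w 0%N)) =
    fun w => \sum_y W y * \1_[set w' : trajectory x | w' 0%N = y] w.
  apply/funext => w; rewrite (bigD1 (w 0%N))//= big1 ?addr0.
    by rewrite indicE mem_set ?mulr1.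
  by move=> y /eqP yw; rewrite indicE memNset ?mulr0//= => /esym.
rewrite mean_sum => [|y]; last exact: bounded_rvZ.
rewrite (bigD1 x)//= big1 ?addr0 => [|y /eqP yx].
  by rewrite meanZ// mean_indic// P_law.1 mulr1.
rewrite meanZ// mean_indic// (_ : P _ = 0%E) ?mulr0//.
apply/eqP; rewrite -measure_le0.
have <- : P (~` [set w | w 0%N = x]) = 0%E.
  by rewrite probability_setC// P_law.1 subee.
apply: le_measure; rewrite ?inE//; first exact: measurableC.
by move=> w /= -> /yx.
Qed.

(** Markov property: expanding the adapted factor over histories reduces the
    claim to the defining product formula of the path law. *)
Lemma mean_next_state n g (W : E -> R) : history_adapted n g ->
  mean P (fun w => g w * W (w n.+1)) =
  mean P (fun w => g w * \sum_y p (@pi n (history n w)) (w n) y * W y).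
Proof.
move=> gn; rewrite [RHS](@mean_history_adapted n); last first.
  move=> w w' ww'; rewrite (gn _ _ ww') ww' (history_last ww').
  by [].
pose A h y := [set w : trajectory x | history n w = h /\ w n.+1 = y].
have mA h y : measurable (A h y).
  have -> : A h y = [set w | history n w = h] `&` [set w | w n.+1 = y] by [].
  by apply: measurableI; [exact: measurable_history|exact: measurable_coordinate].
have bA h y := bounded_rv_indic (R := R) (mA h y).
have -> : (fun w => g w * W (w n.+1)) = fun w => \sum_(h : n.+1.-tuple E) \sum_y
    (g (extend_history h) * W y) * \1_(A h y) w.
  apply/funext => w; rewrite (history_adaptedE w gn) mulr_suml; apply: eq_bigr => h _.
  rewrite (bigD1 (w n.+1))//= big1 ?addr0 => [|y /eqP yw]; last first.
    by rewrite indicE memNset ?mulr0// => -[_ /esym].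
  rewrite mulrAC !indicE; congr (_ * (_ _)%:R); apply/idP/idP; rewrite !inE /A /=.
    by move=> ->.
  by case.
rewrite mean_sum => [|h]; last by apply: bounded_rv_sum => y; exact: bounded_rvZ.
apply: eq_bigr => h _; rewrite mean_sum => [|y]; last exact: bounded_rvZ.
rewrite -mulrA mulr_suml mulr_sumr; apply: eq_bigr => y _.
rewrite meanZ// mean_indic// P_law.2 fineM ?fin_num_measure//; last exact: measurable_history.
rewrite history_extend extend_history_last /=; ring.
Qed.

End histories.

(** * Discounted rewards and the verification inequality *)

Section discounted_rewards.
Context {R : realType} {E U : finType} (c : E -> U -> R) (b : R).
Hypothesis b01 : 0 < b < 1.

Let b_gt0 : 0 < b. Proof. by case/andP: b01. Qed.
Let b_lt1 : b < 1. Proof. by case/andP: b01. Qed.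

(** The geometric series of the crude bound of the reward by the sum of all its
    absolute values. *)
Definition reward_bound : R := (\sum_x \sum_a `|c x a|) / (1 - b).

Lemma reward_bound_ge0 : 0 <= reward_bound.
Proof.
rewrite divr_ge0//; last by rewrite subr_ge0 ltW.
by apply: sumr_ge0 => x _; apply: sumr_ge0.
Qed.

Lemma norm_reward_le x a : `|c x a| <= reward_bound * (1 - b).
Proof.
rewrite divfK; last by rewrite subr_eq0 gt_eqF.
rewrite (bigD1 x)//= (bigD1 a)//= -addrA lerDl addr_ge0// ?sumr_ge0//.
by move=> y _; rewrite sumr_ge0.
Qed.

Section one_policy.
Context (x : E) (pi : policy E U).
Implicit Type w : trajectory x.

Definition partial_reward n w : R :=
  series (fun i => b ^+ i * c (w i) (@pi i (history i w))) n.

Lemma partial_rewardS n w : partial_reward n.+1 w =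
  partial_reward n w + b ^+ n * c (w n) (@pi n (history n w)).
Proof. by rewrite /partial_reward /series /= big_nat_recr. Qed.

Lemma partial_reward0 w : partial_reward 0 w = 0.
Proof. by rewrite /partial_reward /series /= big_geq. Qed.

Lemma partial_reward_adapted n (F : R -> R) :
  history_adapted n (fun w => F (partial_reward n.+1 w)).
Proof.
move=> w w' ww'; congr F; rewrite /partial_reward /series /= !big_mkord.
apply: eq_bigr => i _; have iw := history_widen (ltn_ord i : (i <= n)%N) ww'.
by rewrite iw (history_last iw).
Qed.

Lemma bounded_rv_partial_reward n : bounded_rv (partial_reward n).
Proof.
case: n => [|n]; first by rewrite (funext partial_reward0); exact: bounded_rv_cst.
exact: bounded_rv_history_adapted (partial_reward_adapted id).
Qed.

Lemma norm_partial_reward_le n w :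
  `|partial_reward n w| <= reward_bound * (1 - b ^+ n).
Proof.
elim: n => [|n IH]; first by rewrite partial_reward0 normr0 expr0 subrr mulr0.
rewrite partial_rewardS; apply: le_trans (ler_normD _ _) _.
apply: (@le_trans _ _ (reward_bound * (1 - b ^+ n) + b ^+ n * (reward_bound * (1 - b)))).
  apply: lerD => //; rewrite normrM normrX (gtr0_norm b_gt0).
  rewrite ler_wpM2l ?exprn_ge0 ?(ltW b_gt0)//.
  exact: norm_reward_le.
by rewrite exprS; lra.
Qed.

Lemma partial_reward_bounded n w : `|partial_reward n w| <= reward_bound.
Proof.
apply: le_trans (norm_partial_reward_le n w) _; apply: ler_piMr; first exact: reward_bound_ge0.
by rewrite gerBl exprn_ge0// ltW.
Qed.

Lemma cvg_partial_reward w :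
  partial_reward n w @[n --> \oo] --> discounted_reward c b pi w.
Proof.
apply: normed_cvg; apply: (@series_le_cvg _ _ (geometric (reward_bound * (1 - b)) b)) => //=.
- move=> n; rewrite mulr_ge0 ?exprn_ge0// ?(ltW b_gt0)// mulr_ge0 ?reward_bound_ge0//.
  by rewrite subr_ge0 ltW.
- move=> n; rewrite normrM normrX (gtr0_norm b_gt0) mulrC.
  rewrite ler_wpM2r ?exprn_ge0 ?(ltW b_gt0)//.
  exact: norm_reward_le.
- by apply: is_cvg_geometric_series; rewrite gtr0_norm.
Qed.

Lemma bounded_rv_discounted_reward :
  bounded_rv (discounted_reward (x := x) c b pi).
Proof.
apply: bounded_rv_lim cvg_partial_reward => [n|n w].
  exact: bounded_rv_partial_reward.
exact: partial_reward_bounded.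
Qed.

Lemma norm_discounted_reward_le w : `|discounted_reward c b pi w| <= reward_bound.
Proof.
have h : `|partial_reward n w| @[n --> \oo] --> `|discounted_reward c b pi w|.
  by apply: cvg_norm; exact: cvg_partial_reward.
rewrite -(cvg_lim _ h)//; apply: limr_le; first by apply/cvg_ex; eexists; exact: h.
by apply: nearW => n; exact: partial_reward_bounded.
Qed.

End one_policy.

Section dynamic_programming.
Context (p : U -> E -> E -> R).
Hypothesis p_trans : forall a, transition_matrix (p a).

(** The exponential of the reward of one step times the mean continuation value; the
    parameter of the continuation is left to [W]. *)
Definition bellman (z : R) (a : U) (W : E -> R) (x : E) : R :=
  expR (z * c x a) * \sum_y p a x y * W y.

Lemma le_bellman z a W W' x : (forall y, W y <= W' y) ->
  bellman z a W x <= bellman z a W' x.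
Proof.
move=> WW'; rewrite /bellman ler_wpM2l ?expR_ge0//; apply: ler_sum => y _.
by rewrite ler_wpM2l//; exact: (p_trans a).1.
Qed.

Lemma bellmanZ r z a W x : bellman z a (fun y => r * W y) x = r * bellman z a W x.
Proof.
rewrite /bellman mulrCA; congr (_ * _); rewrite mulr_sumr.
by apply: eq_bigr => y _; rewrite mulrCA.
Qed.

Definition exp_value (z : R) (pi : policy E U) (x : E) : R :=
  mean (path_law p pi x) (fun w => expR (z * discounted_reward c b pi w)).

Section one_policy.
Context (x : E) (pi : policy E U) (z : R).
Let P := path_law p pi x.
Let P_law : is_path_law p pi P. Proof. exact: path_lawP. Qed.
Implicit Type W : nat -> E -> R.

(** The reward collected before time [n] is combined with the promised
    continuation [W n], in the current state. It interpolates between [W 0 x] at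
    time 0 and the value of the policy at infinity. *)
Definition value_process W n : R :=
  mean P (fun w => expR (z * partial_reward pi n w) * W n (w n)).

Lemma bounded_rv_exp_partial_reward n :
  bounded_rv (fun w : trajectory x => expR (z * partial_reward pi n w)).
Proof. by apply: bounded_rv_expR; apply: bounded_rvZ; exact: bounded_rv_partial_reward. Qed.

Lemma bounded_rv_state n (F : E -> R) : bounded_rv (fun w : trajectory x => F (w n)).
Proof.
apply: (@bounded_rv_history_adapted _ _ _ n) => w w' ww'.
by rewrite (history_last ww').
Qed.

Lemma bounded_rv_state_action n (F : E -> U -> R) :
  bounded_rv (fun w : trajectory x => F (w n) (@pi n (history n w))).
Proof.
apply: (@bounded_rv_history_adapted _ _ _ n) => w w' ww'.
by rewrite ww' (history_last ww').
Qed.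

Lemma value_process0 W : value_process W 0 = W 0%N x.
Proof.
rewrite -(mean_initial_state P_law); congr mean; apply/funext => w.
by rewrite partial_reward0 mulr0 expR0 mul1r.
Qed.

(** By the Markov property, conditioning on the history up to time [n] replaces the
    next state by its mean; the reward of step [n] is then absorbed in the
    operator. *)
Lemma value_processS W n : value_process W n.+1 =
  mean P (fun w => expR (z * partial_reward pi n w) *
                   bellman (z * b ^+ n) (@pi n (history n w)) (W n.+1) (w n)).
Proof.
rewrite /value_process (mean_next_state P_law) //; last first.
  exact: (@partial_reward_adapted x pi n (fun s => expR (z * s))).
congr mean; apply/funext => w.
by rewrite partial_rewardS /bellman mulrA -expRD -mulrA -mulrDr.
Qed.

Lemma cvg_value_process W tau B : 
  (forall n y, `|W n y - tau| <= B * b ^+ n) ->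
  value_process W n @[n --> \oo] --> tau * exp_value z pi x.
Proof.
move=> WB; have B0 : 0 <= B.
  by have := WB 0 x; rewrite expr0 mulr1; apply: le_trans.
have bS := bounded_rv_discounted_reward x pi.
rewrite /exp_value -meanZ; last by apply: bounded_rv_expR; exact: bounded_rvZ.
have WbB n y : `|W n y| <= `|tau| + B.
  rewrite -[W n y](subrK tau) addrC; apply: le_trans (ler_normD _ _) _.
  rewrite lerD2l; apply: le_trans (WB n y) _; apply: ler_piMr => //.
  by apply: exprn_ile1; rewrite ?ltW.
apply: (@cvg_mean _ _ _ P _ _ (expR (`|z| * reward_bound) * (`|tau| + B))).
- move=> n; apply: bounded_rvM; first exact: bounded_rv_exp_partial_reward.
  exact: bounded_rv_state.
- move=> n w; rewrite normrM; apply: ler_pM => //.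
  rewrite ger0_norm ?expR_ge0// ler_expR; apply: le_trans (ler_norm _) _.
  by rewrite normrM ler_wpM2l// partial_reward_bounded.
move=> w; rewrite mulrC; apply: cvgM.
  apply: (@cvg_comp _ _ _ (fun n => z * partial_reward pi n w) expR _
    (nbhs (z * discounted_reward c b pi w))).
    by apply: cvgM; [exact: cvg_cst|exact: cvg_partial_reward].
  exact: continuous_expR.
have Bb : B * b ^+ n @[n --> \oo] --> 0.
  rewrite -[X in _ --> X](mulr0 B); apply: cvgM; first exact: cvg_cst.
  by apply: cvg_expr; rewrite gtr0_norm.
apply/cvgrPdist_lt => e e0; move/cvgrPdist_lt : Bb => /(_ e e0).
apply: filterS => n /=; rewrite sub0r normrN => Be; rewrite distrC.
apply: le_lt_trans (WB n _) _; exact: le_lt_trans (ler_norm _) Be.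
Qed.

Lemma value_process_le W n : 
  (forall k (h : k.+1.-tuple E), let y := tnth h ord_max in
    bellman (z * b ^+ k) (@pi k h) (W k.+1) y <= W k y) ->
  value_process W n <= W 0%N x.
Proof.
move=> WT; elim: n => [|n IH]; first by rewrite value_process0.
apply: le_trans IH; rewrite value_processS; apply: le_mean.
- apply: bounded_rvM; first exact: bounded_rv_exp_partial_reward.
  exact: (bounded_rv_state_action n (fun y a => bellman _ a _ y)).
- by apply: bounded_rvM; [exact: bounded_rv_exp_partial_reward|exact: bounded_rv_state].
- by move=> w; rewrite ler_wpM2l ?expR_ge0//; have := WT n (history n w); rewrite tnth_mktuple.
Qed.

(** Verification: under this hypothesis the value process stays below its
    initial value [W 0 x], and its limit is [tau] times the value of the
    policy. *)
Lemma exp_value_le W tau B :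
  (forall k (h : k.+1.-tuple E), let y := tnth h ord_max in
    bellman (z * b ^+ k) (@pi k h) (W k.+1) y <= W k y) ->
  (forall n y, `|W n y - tau| <= B * b ^+ n) ->
  tau * exp_value z pi x <= W 0%N x.
Proof.
move=> WT WB; have h := cvg_value_process WB.
rewrite -(cvg_lim _ h)//; apply: limr_le; first by apply/cvg_ex; eexists; exact: h.
by apply: nearW => n; exact: value_process_le.
Qed.

End one_policy.
End dynamic_programming.
End discounted_rewards.

(** * Stationary policies and policy improvement *)

Section optimality.
Context {R : realType} {E U : finType} (c : E -> U -> R) (b : R).
Context (p : U -> E -> E -> R).
Hypothesis b01 : 0 < b < 1.
Hypothesis p_trans : forall a, transition_matrix (p a).

Let b_gt0 : 0 < b. Proof. by case/andP: b01. Qed.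

Local Notation T := (bellman c p).
Local Notation V := (exp_value c b p).
Local Notation K := (reward_bound c b).

Definition stationary (f : E -> U) : policy E U := policy_of_markov (fun=> f).

Lemma exp_value_gt0 z pi x : 0 < V z pi x.
Proof.
by apply: mean_expR_gt0; apply: bounded_rvZ; exact: bounded_rv_discounted_reward.
Qed.

Lemma J_exp_value g pi x : g != 0 -> J p c g x pi b = g^-1 * ln (V g pi x).
Proof. by move=> /negbTE g0; rewrite /J g0. Qed.

(** The values of all policies tend to 1 at the same geometric rate when the parameter
    runs along [z * b ^+ n]: this is the terminal condition of the
    Bellman equations. *)
Lemma exp_value_near1 z pi x n :
  `|V (z * b ^+ n) pi x - 1| <=
    `|z| * K * expR (`|z| * K) * b ^+ n.
Proof.
have bS := bounded_rv_discounted_reward c b01 x pi.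
have be : bounded_rv (fun w => expR (z * b ^+ n * discounted_reward (x := x) c b pi w)).
  by apply: bounded_rv_expR; exact: bounded_rvZ.
rewrite -[X in _ - X](mean_cst (path_law p pi x)) -meanB//; last exact: bounded_rv_cst.
apply: norm_mean_le.
  by apply: bounded_rvB => //; exact: bounded_rv_cst.
move=> w; have := expR_taylor (z * b ^+ n * discounted_reward c b pi w) 1.
rewrite big_ord1 expr0 divr1 expr1 => /le_trans; apply.
have bn0 : 0 <= b ^+ n by rewrite exprn_ge0// ltW.
have bn1 : b ^+ n <= 1 by rewrite exprn_ile1 ?ltW//; case/andP: b01.
have zS : `|z * b ^+ n * discounted_reward c b pi w| <= `|z| * K * b ^+ n.
  rewrite !normrM (ger0_norm bn0) mulrAC ler_wpM2r// ler_wpM2l//.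
  exact: norm_discounted_reward_le.
rewrite [leRHS]mulrAC; apply: ler_pM; rewrite ?expR_ge0// ler_expR.
apply: le_trans zS _; apply: ler_piMr => //.
by rewrite mulr_ge0// reward_bound_ge0.
Qed.

(** The verification inequality applied to [- W] and [- tau]: the operator is linear. *)
Lemma exp_value_ge (u : markov_policy E U) z x (W : nat -> E -> R) tau B :
  (forall k y, W k y <= T (z * b ^+ k) (u k y) (W k.+1) y) ->
  (forall n y, `|W n y - tau| <= B * b ^+ n) ->
  W 0%N x <= tau * V z (policy_of_markov u) x.
Proof.
move=> WT WB.
suff : - tau * V z (policy_of_markov u) x <= -1 * W 0%N x.
  by rewrite mulN1r mulNr lerN2.
apply: (@exp_value_le _ _ _ _ _ b01 _ p_trans _ _ _ (fun n y => -1 * W n y) _ B).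
- by move=> k h; cbv zeta; rewrite bellmanZ !mulN1r lerN2; exact: WT.
- by move=> n y; rewrite mulN1r -opprD normrN.
Qed.

Fixpoint horizon_value (f : E -> U) n (z : R) (x : E) : R :=
  if n is m.+1 then T z (f x) (horizon_value f m (z * b)) x else 1.

(** The value process of the remaining-horizon values is constant in time; it
    is read off at both ends. *)
Lemma mean_horizon f z x n :
  mean (path_law p (stationary f) x)
    (fun w => expR (z * partial_reward c b (stationary f) n w)) = horizon_value f n z x.
Proof.
pose W k := horizon_value f (n - k) (z * b ^+ k).
have Wk k : (k <= n)%N -> value_process c b p x (stationary f) z W k = horizon_value f n z x.
  elim: k => [|k IH] kn.
    by rewrite value_process0// /W expr0 mulr1 subn0.
  rewrite -IH ?(ltnW kn)// value_processS//; congr mean; apply/funext => w; congr (_ * _).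
  rewrite /W -(subnSK kn) /= /stationary /policy_of_markov tnth_mktuple.
  by rewrite exprSr mulrA.
rewrite -(Wk n)//; congr mean; apply/funext => w.
by rewrite /W subnn /= mulr1.
Qed.

Lemma cvg_horizon_value f z x :
  horizon_value f n z x @[n --> \oo] --> V z (stationary f) x.
Proof.
rewrite -[V _ _ _]mul1r.
have <- : value_process c b p x (stationary f) z (fun _ _ => 1) =
    fun n => horizon_value f n z x.
  apply/funext => n; rewrite -mean_horizon; congr mean.
  by apply/funext => w; rewrite mulr1.
apply: (@cvg_value_process _ _ _ _ _ b01 _ _ _ _ _ _ 0) => n y.
by rewrite subrr normr0 mul0r.
Qed.

(** Passing to the limit in the recursion on the horizon avoids shifting the path
    law itself. *)
Lemma exp_value_stationary f z x :
  V z (stationary f) x =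
  T z (f x) (V (z * b) (stationary f)) x.
Proof.
have h1 : horizon_value f n.+1 z x @[n --> \oo] --> V z (stationary f) x.
  by rewrite (cvg_shiftS (fun n => horizon_value f n z x)); exact: cvg_horizon_value.
have h2 : horizon_value f n.+1 z x @[n --> \oo] -->
    T z (f x) (V (z * b) (stationary f)) x.
  rewrite /= /bellman; apply: cvgM; first exact: cvg_cst.
  apply: cvg_big => [|y _]; first exact: add_continuous.
  apply: cvgM; first exact: cvg_cst.
  exact: cvg_horizon_value.
by rewrite -(cvg_lim _ h1)// (cvg_lim _ h2).
Qed.

(** Optimality equations at the parameters [z * b ^+ n], solved by the actions of
    [u], with the terminal value [tau] at infinity; the sign of [tau] selects
    maximization or minimization of the exponential mean. *)
Definition bellman_solution tau z (u : markov_policy E U) (W : nat -> E -> R) :=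
  [/\ forall n a x, T (z * b ^+ n) a (W n.+1) x <= W n x,
      forall n x, T (z * b ^+ n) (u n x) (W n.+1) x = W n x &
      exists B, forall n x, `|W n x - tau| <= B * b ^+ n].

Lemma bellman_solution_optimal tau z u W pi x : bellman_solution tau z u W ->
  tau * V z pi x <= tau * V z (policy_of_markov u) x.
Proof.
move=> [WT Wu [B WB]]; apply: (@le_trans _ _ (W 0%N x)).
  by apply: exp_value_le WB => // k h; exact: WT.
by apply: exp_value_ge WB => k y; rewrite Wu.
Qed.

Definition policy_cons (a : E -> U) (u : markov_policy E U) : markov_policy E U :=
  fun n => if n is m.+1 then u m else a.

Lemma bellman_solution_cons tau z u W : (0 < #|U|)%N ->
  bellman_solution tau (z * b) u W ->
  exists a W', bellman_solution tau z (policy_cons a u) W'.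
Proof.
move=> /card_gt0P[a0 _] [WT Wu [B WB]].
have [a amax] : {a : E -> U & forall x a', T z a' (W 0%N) x <= T z (a x) (W 0%N) x}.
  apply: (@choice _ _ (fun x a => forall a', T z a' (W 0%N) x <= T z a (W 0%N) x)) => x.
  have [//|a _ amax] := @Order.TotalTheory.arg_maxP _ _ _ a0 xpredT
    (fun a => T z a (W 0%N) x).
  by exists a => a'; exact: amax.
pose W' n := if n is m.+1 then W m else fun x => T z (a x) (W 0%N) x.
have zb n : z * b ^+ n.+1 = z * b * b ^+ n by rewrite exprS mulrA.
exists a, W'; split.
- by move=> [|n] a' x; rewrite ?expr0 ?mulr1 ?zb /=; [exact: amax|exact: WT].
- by move=> [|n] x; rewrite ?expr0 ?mulr1 ?zb /=.
have B0 (x : E) : 0 <= B by have := WB 0%N x; rewrite expr0 mulr1; apply: le_trans.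
(* The shift costs a factor [b]; the sum takes care of the new first term. *)
exists (B / b + \sum_x `|W' 0%N x - tau|) => -[|n] x.
  rewrite expr0 mulr1 (bigD1 x)//= addrCA lerDl addr_ge0 ?sumr_ge0//.
  by rewrite divr_ge0 ?(B0 x)// ltW.
apply: le_trans (WB n x) _; rewrite exprS mulrA ler_wpM2r ?exprn_ge0 ?(ltW b_gt0)//.
rewrite mulrDl divfK ?gt_eqF// lerDl mulr_ge0 ?sumr_ge0//.
exact: ltW.
Qed.

(** Induction on [N], the step being one maximization ([bellman_solution_cons]):
    each one divides the parameter by [b] and prepends a decision rule. *)
Lemma bellman_solution_backward tau N : (0 < #|U|)%N -> forall z f W,
  bellman_solution tau (z * b ^+ N) (fun=> f) W ->
  exists us W', bellman_solution tau z (nth f us) W'.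
Proof.
move=> U0; elim: N => [|N IH] z f W; last first.
  rewrite exprS mulrA => /IH[us [W1 /(bellman_solution_cons U0)[a [W2 H]]]].
  by exists (a :: us), W2; congr (bellman_solution _ _ _ _) : H; apply/funext => -[].
rewrite expr0 mulr1 => H; exists [::], W.
by congr (bellman_solution _ _ _ _) : H; apply/funext => n; rewrite nth_nil.
Qed.

(** The gain from playing [a] once before following [f] is a finite combination
    of the moment generating functions of the variables c(x, a) + b S, one for
    each next state, and of S itself. *)
Lemma power_series_germ_improvement tau a f x : exists s,
  power_series_germ (fun z =>
    T z a (fun y => tau * V (z * b) (stationary f) y) x -
    tau * V z (stationary f) x) s.
Proof.
have bS y := bounded_rv_discounted_reward c b01 y (stationary f).
have bY y : bounded_rv (fun w => c x a + b * discounted_reward (x := y) c b (stationary f) w).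
  by apply: bounded_rvD; [exact: bounded_rv_cst|exact: bounded_rvZ].
eexists; have -> : (fun z => T z a (fun y => tau * V (z * b) (stationary f) y) x -
    tau * V z (stationary f) x) = (fun z =>
  \sum_y tau * p a x y * mean (path_law p (stationary f) y)
     (fun w => expR (z * (c x a + b * discounted_reward c b (stationary f) w)))
   + - tau * mean (path_law p (stationary f) x)
     (fun w => expR (z * discounted_reward c b (stationary f) w))).
  apply/funext => z; rewrite mulNr; congr (_ - _).
  rewrite /bellman mulr_sumr; apply: eq_bigr => y _.
  have -> : mean (path_law p (stationary f) y)
     (fun w => expR (z * (c x a + b * discounted_reward c b (stationary f) w))) =
     expR (z * c x a) * V (z * b) (stationary f) y.
    rewrite -meanZ; last by apply: bounded_rv_expR; exact: bounded_rvZ.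
    by congr mean; apply/funext => w; rewrite -expRD; congr expR; ring.
  ring.
apply: power_series_germD.
  apply: power_series_germ_sum => y; apply: power_series_germZ.
  exact: power_series_germ_mean.
by apply: power_series_germZ; exact: power_series_germ_mean.
Qed.

(** The values of [f] satisfy W <= T W for the operators of [f'], so
    [exp_value_ge] makes [f'] at least as good as [f] at every rank; strictness at
    [x0] comes from the first step alone. The improvement is required at all later
    ranks because [f'] uses the new action each time it visits [x0]. *)
Lemma policy_improvement tau f x0 a0 z :
  (forall n, let z' := z * b ^+ n in tau * V z' (stationary f) x0 <
    T z' a0 (fun y => tau * V (z' * b) (stationary f) y) x0) ->
  let f' y := if y == x0 then a0 else f y in
  (forall y, tau * V z (stationary f) y <= tau * V z (stationary f') y) /\
  tau * V z (stationary f) x0 < tau * V z (stationary f') x0.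
Proof.
move=> imp f'.
have VT z' y : tau * V z' (stationary f) y =
    T z' (f y) (fun y => tau * V (z' * b) (stationary f) y) y.
  by rewrite exp_value_stationary bellmanZ.
have ge k y : tau * V (z * b ^+ k) (stationary f) y <=
    tau * V (z * b ^+ k) (stationary f') y.
  have := @exp_value_ge (fun=> f') (z * b ^+ k) y
    (fun n y => tau * V (z * b ^+ k * b ^+ n) (stationary f) y) tau
    (`|tau| * (`|z * b ^+ k| * K * expR (`|z * b ^+ k| * K))).
  rewrite expr0 mulr1; apply.
    move=> n y'; rewrite exprSr mulrA /f'; case: eqP => [->|_].
      by apply: ltW; have := imp (k + n)%N; rewrite /= exprD !mulrA.
    by rewrite -VT.
  move=> n y'; rewrite -[X in _ - X]mulr1 -mulrBr normrM -[leRHS]mulrA ler_wpM2l//.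
  exact: exp_value_near1.
have ge0 y : tau * V z (stationary f) y <= tau * V z (stationary f') y.
  by have := ge 0%N y; rewrite expr0 mulr1.
split => //.
have := imp 0%N; rewrite /= expr0 mulr1 => /lt_le_trans; apply.
have f'x0 : f' x0 = a0 by rewrite /f' eqxx.
rewrite exp_value_stationary f'x0 -bellmanZ; apply: le_bellman => // y.
by have := ge 1%N y; rewrite expr1.
Qed.

(** The comparisons with one-step deviations are settled from a common rank [M]
    on; maximality of [f] at the single rank [M] then rules out every profitable
    deviation at every later rank. *)
Lemma stationary_solution_near0 tau z : (0 < #|U|)%N ->
  exists f N, forall n, (N <= n)%N -> exists W, bellman_solution tau (z * b ^+ n) (fun=> f) W.
Proof.
move=> /card_gt0P[a0 _].
pose D (f : E -> U) x a z := T z a (fun y => tau * V (z * b) (stationary f) y) x -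
    tau * V z (stationary f) x.
pose settled (i : {ffun E -> U} * E * U) N :=
  (forall n, (N <= n)%N -> D i.1.1 i.1.2 i.2 (z * b ^+ n) <= 0) \/
  (forall n, (N <= n)%N -> 0 < D i.1.1 i.1.2 i.2 (z * b ^+ n)).
have [N HN] : {N & forall i, settled i (N i)}.
  apply: choice => -[[f x] a].
  have [s Ds] := power_series_germ_improvement tau a f x.
  exact: power_series_germ_sign Ds b01.
pose M := \max_i N i.
have NM i : (N i <= M)%N by exact: leq_bigmax.
case: (@Order.TotalTheory.arg_maxP _ _ _ ([ffun=> a0] : {ffun E -> U}) xpredT
  (fun f : {ffun E -> U} => \sum_y tau * V (z * b ^+ M) (stationary f) y)) => // f _ fmax.
have opt n a x : (M <= n)%N -> D f x a (z * b ^+ n) <= 0.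
  move=> Mn; have [H|H] := HN (f, x, a); first exact/H/(leq_trans (NM _)).
  exfalso; have [|ge gt] := @policy_improvement tau f x a (z * b ^+ M).
    move=> m /=; rewrite -subr_gt0; have := H (M + m)%N.
    rewrite exprD mulrA; apply; exact: leq_trans (NM _) (leq_addr _ _).
  pose f' y : U := if y == x then a else f y.
  have := fmax [ffun y => f' y] isT; apply/negP; rewrite -ltNge.
  have -> : stationary [ffun y => f' y] = stationary f'.
    by congr stationary; apply/funext => y; rewrite ffunE.
  rewrite (bigD1 x)//= [ltRHS](bigD1 x)//=; apply: ltr_leD => //.
  exact: ler_sum.
exists f, M => n Mn.
exists (fun k x => tau * V (z * b ^+ n * b ^+ k) (stationary f) x); split.
- move=> k a x; have := opt (n + k)%N a x (leq_trans Mn (leq_addr _ _)).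
  by rewrite /D subr_le0 exprSr exprD !mulrA.
- by move=> k x; rewrite bellmanZ [in RHS]exp_value_stationary exprSr mulrA.
exists (`|tau| * (`|z * b ^+ n| * K * expR (`|z * b ^+ n| * K))) => k x.
rewrite -[X in _ - X]mulr1 -mulrBr normrM -[leRHS]mulrA ler_wpM2l//.
exact: exp_value_near1.
Qed.

End optimality.


(** * The theorem *)

Theorem theorem4p5 (R : realType) (E U : finType)
  (E_gt0 : (0 < #|E|)%N) (U_gt0 : (0 < #|U|)%N)
  (p : U -> E -> E -> R) (p_trans : forall a, transition_matrix (p a))
  (c : E -> U -> R) (gamma beta : R) (beta01 : 0 < beta < 1) :
  exists2 u : markov_policy E U,
    optimal_markov p c beta gamma u & ultimately_stationary u.
Proof.
have max_optimal u :
    (forall x pi, J p c gamma x pi beta <= J p c gamma x (policy_of_markov u) beta) ->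
    optimal_markov p c beta gamma u.
  move=> Ju x; apply/eqP; rewrite eq_le; apply/andP; split.
    by apply: ereal_sup_ubound; exists (policy_of_markov u).
  by apply: ge_ereal_sup => _ [pi _ <-]; rewrite lee_fin.
have [gamma0|gamma_neq0] := eqVneq gamma 0; last first.
  pose tau := Num.sg gamma.
  have [f [N /(_ N (leqnn N))[W0 H0]]] :=
    stationary_solution_near0 c beta01 p_trans tau gamma U_gt0.
  have [us [W H]] := bellman_solution_backward beta01 U_gt0 H0.
  exists (nth f us); last by exists us, f.
  apply: max_optimal => x pi; rewrite !J_exp_value//.
  have := exp_value_gt0 c p beta01 gamma pi x.
  have := exp_value_gt0 c p beta01 gamma (policy_of_markov (nth f us)) x.
  have := bellman_solution_optimal beta01 p_trans pi x H.
  move: (exp_value _ _ _ _ _ _) (exp_value _ _ _ _ _ _) => Vpi Vu VV Vu_gt0 Vpi_gt0.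
  move: VV; rewrite /tau; have [g0|g0|/eqP] := ltrgtP gamma 0; last first.
  - by rewrite (negbTE gamma_neq0).
  - rewrite gtr0_sg// !mul1r => VV; rewrite ler_wpM2l ?invr_ge0 ?(ltW g0)//.
    by rewrite ler_ln.
  - rewrite ltr0_sg// !mulN1r lerN2 => VV; rewrite ler_wnM2l ?invr_le0 ?(ltW g0)//.
    by rewrite ler_ln.
have [f [N H]] := stationary_solution_near0 c beta01 p_trans 1 1 U_gt0.
exists (fun=> f); last by exists [::], f => n; rewrite nth_nil.
apply: max_optimal => x pi; rewrite /J gamma0 eqxx.
have bS pi' := bounded_rv_discounted_reward c beta01 x pi'.
have germ pi' := power_series_germ_mean (path_law p pi' x) (bS pi').
have := power_series_germD (germ (stationary f)) (power_series_germZ (-1) (germ pi)).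
set D := fun z => _ + _; set s := fun k => _ + _ => Ds.
have s0 : s 0%N = 0.
  rewrite /s; under [X in mean _ X]eq_fun do rewrite expr0.
  under [X in _ + -1 * (mean _ X / _)]eq_fun do rewrite expr0.
  by rewrite !mean_cst mulN1r subrr.
have s1 : s 1%N = mean (path_law p (stationary f) x)
       (fun w => discounted_reward c beta (stationary f) w)
     - mean (path_law p pi x) (fun w => discounted_reward c beta pi w).
  by rewrite /s !divr1 mulN1r.
suff : 0 <= s 1%N by rewrite s1 subr_ge0.
(* A negative first-order term would make [pi] better than [f] at [beta ^+ n]. *)
rewrite leNgt; apply/negP => s_lt0.
have [|r r0 Dr] := power_series_germ_leading Ds _ (ltr0_neq0 s_lt0).
  by case.
have [beta0 beta1] := andP beta01.
have [M HM] : exists M, forall n, (M <= n)%N -> beta ^+ n < r.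
  have : beta ^+ n @[n --> \oo] --> 0 by apply: cvg_expr; rewrite gtr0_norm.
  move/cvgrPdist_lt => /(_ r r0)[M _ HM]; exists M => n Mn.
  by have := HM n Mn; rewrite /= sub0r normrN; apply: le_lt_trans; exact: ler_norm.
pose n := maxn N M; pose z := beta ^+ n.
have z0 : 0 < z by exact: exprn_gt0.
have := Dr z; rewrite gtr0_norm// z0 HM ?leq_maxr// => /(_ isT).
have [W HW] := H n (leq_maxl _ _).
have := bellman_solution_optimal beta01 p_trans pi x HW; rewrite !mul1r => VV.
rewrite nmulr_lgt0 ?nmulr_rlt0 ?expr1// /D mulN1r subr_lt0 ltNge.
by apply/negP; rewrite negbK.
Qed.
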